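(* Consider the fully-random corruption model with $p<\frac12$, and let $\mathcal G$ be the observed noisy binary tensor. Then solving Problem (P) is equivalent to finding the maximum likelihood estimator of the ground truth: for binary vectors $x,y,z$, the triple $(x,y,z)$ is an optimal solution of Problem (P) if and only if the tensor $x\otimes y\otimes z$ maximizes the likelihood $\mathbb P[\mathcal G\mid\mathcal W]$ over all tensors $\mathcal W$ of the form $x'\otimes y'\otimes z'$ with $x'\in\{0,1\}^n,y'\in\{0,1\}^m,z'\in\{0,1\}^l$. Furthermore, if all ground truth rank-one binary tensors are equally likely a priori, then solving Problem (P) is equivalent, in the same sense, to finding the maximum a posteriori estimator, i.e. to maximizing $\mathbb P[\mathcal W\mid\mathcal G]$ over all such tensors $\mathcal W$.
   Context: For vectors $x\in\mathbb R^n,y\in\mathbb R^m,z\in\mathbb R^l$, $x\otimes y\otimes z$ is the $n\times m\times l$ tensor with $(i,j,k)$ entry $x_iy_jz_k$; $\|\cdot\|$ is the Frobenius norm. A binary tensor has rank one if it is of the form $x\otimes y\otimes z$ with $x,y,z$ binary vectors. Fully-random corruption model: given a ground truth $\mathcal W=x\otimes y\otimes z$ with $x,y,z$ binary vectors and $p\in[0,1]$, the random noisy binary tensor $\mathcal G=(g_{ijk})$ is obtained by corrupting each entry independently: $g_{ijk}=1-w_{ijk}$ with probability $p$ and $g_{ijk}=w_{ijk}$ with probability $1-p$. $\mathbb P[\mathcal G\mid\mathcal W]$ denotes the probability that $\mathcal G$ is observed given that $\mathcal W$ is the ground truth. The observed tensor $\mathcal G$ is a tensor that has positive probability under at least one ground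 truth. Problem (P), with input $\mathcal G$: minimize $\|\mathcal G-x\otimes y\otimes z\|^2$ over $x\in\{0,1\}^n$, $y\in\{0,1\}^m$, $z\in\{0,1\}^l$. *)

(* Defs.v *)
From HB Require Import structures.
From mathcomp Require Import all_boot all_order all_algebra.
From mathcomp Require Import all_classical all_reals all_analysis.

Set Implicit Arguments.
Unset Strict Implicit.
Unset Printing Implicit Defensive.

Import Order.TTheory GRing.Theory Num.Theory.
Local Open Scope classical_set_scope.
Local Open Scope ring_scope.

Notation idx n m l := ('I_n * 'I_m * 'I_l)%type.
Notation tensor R n m l := {ffun idx n m l -> R}.

Section Tensors.
Variables (R : realType) (n m l : nat).

Definition outer (x : 'rV[R]_n) (y : 'rV[R]_m) (z : 'rV[R]_l) :
    tensor R n m l :=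
  [ffun t => x 0 t.1.1 * y 0 t.1.2 * z 0 t.2].

Definition frobenius (A : tensor R n m l) : R := Num.sqrt (\sum_t A t ^+ 2).

Definition binary_vec k (x : 'rV[R]_k) : Prop :=
  forall i, x 0 i = 0 \/ x 0 i = 1.

(* The zero tensor counts as rank one, since the factors may vanish. *)
Definition rank_one_binary (W : tensor R n m l) : Prop :=
  exists x y z, [/\ binary_vec x, binary_vec y, binary_vec z &
    W = outer x y z].

Definition optimal_solution (G : tensor R n m l)
    (x : 'rV[R]_n) (y : 'rV[R]_m) (z : 'rV[R]_l) : Prop :=
  [/\ binary_vec x, binary_vec y, binary_vec z &
    forall x' y' z', binary_vec x' -> binary_vec y' -> binary_vec z' ->
      frobenius (G - outer x y z) ^+ 2 <= frobenius (G - outer x' y' z') ^+ 2].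

(* [F] is defined on all tensors, but only its values on the tensors
   x' (x) y' (x) z' with binary factors compete. *)
Definition maximizes_over_rank_one (F : tensor R n m l -> R)
    (W : tensor R n m l) : Prop :=
  rank_one_binary W /\ forall W', rank_one_binary W' -> F W' <= F W.

End Tensors.

Section Probability.
Context d (Omega : measurableType d) (R : realType).
Variable P : probability Omega R.

Definition prob (A : set Omega) : R := fine (P A).

Definition cond_prob (A B : set Omega) : R := prob (A `&` B) / prob B.

Definition mutually_independent (I : finType) (A : I -> set Omega) : Prop :=
  (forall i, measurable (A i)) /\
  forall J : {set I},
    prob (\bigcap_(i in [set i | i \in J]) A i) = \prod_(i in J) prob (A i).

Variables (n m l : nat).

(* [C t] is the event that entry [t] gets corrupted. *)
Definition corruption_model (p : R) (C : idx n m l -> set Omega) : Prop :=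
  mutually_independent C /\ forall t, prob (C t) = p.

Definition corrupt (C : idx n m l -> set Omega) (W : tensor R n m l)
    (omega : Omega) : tensor R n m l :=
  [ffun t => if `[< C t omega >] then 1 - W t else W t].

(* P[G | W] for a fixed, non-random, ground truth W. *)
Definition likelihood (C : idx n m l -> set Omega) (G W : tensor R n m l) : R :=
  prob [set omega | corrupt C W omega = G].

Definition observable (C : idx n m l -> set Omega) (G : tensor R n m l) : Prop :=
  exists W, rank_one_binary W /\ 0 < likelihood C G W.

(* A random ground truth [W], independent of the corruption, all rank-one
   binary tensors being equally likely.  The prior is uniform over tensors, not
   over triples of factors (distinct triples can give the same tensor).
   As [W] takes finitely many values, its independence from the corruption
   amounts to the mutual independence of each event {W = w} together with all
   the corruption events. *)
Definition uniform_ground_truth (C : idx n m l -> set Omega)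
    (W : Omega -> tensor R n m l) : Prop :=
  [/\ forall omega, rank_one_binary (W omega),
      forall w w', rank_one_binary w -> rank_one_binary w' ->
        prob [set omega | W omega = w] = prob [set omega | W omega = w'] &
      forall w, rank_one_binary w ->
        mutually_independent (fun o : option (idx n m l) =>
          if o is Some t then C t else [set omega | W omega = w])].

(* P[W = w | G], where the observation is the corruption of the random W. *)
Definition posterior (C : idx n m l -> set Omega) (W : Omega -> tensor R n m l)
    (G w : tensor R n m l) : R :=
  cond_prob [set omega | W omega = w]
            [set omega | corrupt C (W omega) omega = G].

End Probability.

(* Main.v *)
Require Import Defs.
From mathcomp Require Import all_boot all_order all_algebra.
From mathcomp Require Import all_classical all_reals all_analysis.
From mathcomp Require Import lra.
Set Implicit Arguments.
Unset Strict Implicit.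
Unset Printing Implicit Defensive.

Import Order.TTheory GRing.Theory Num.Theory.
Local Open Scope classical_set_scope.
Local Open Scope ring_scope.

(** Fix a binary tensor [G] and a binary ground truth [W], and let [k] be the
    number of entries where they differ.  Both criteria see [W] only through
    [k]: the squared Frobenius distance is [k] itself ([frobenius_hamming]),
    and, since [G] arises from [W] exactly when the [k] differing entries are
    corrupted and the [N - k] others are not, the likelihood is
    [p ^ k * (1 - p) ^ (N - k)] ([likelihoodE]).  As [p < 1 - p], this decreases
    with [k], so minimizing the distance maximizes the likelihood.

    The decrease is strict when [p > 0].  When [p = 0] the likelihood vanishes
    for all [k > 0], and a strict comparison is only available against a positive
    value ([noise_weight_lt]).  Observability repairs this: some competitor has
    positive likelihood, hence so does every maximizer.

    With a uniform prior, Bayes' rule gives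
    [posterior w = (prior / evidence) * likelihood w] with the same factor for
    all rank-one binary [w] ([posteriorE]).  This factor is positive: the prior is, because
    finitely many equally likely tensors carry total mass one ([prior_gt0]), and
    the evidence is at least the prior times a positive likelihood.  Maximizing
    the posterior is thus the same problem. *)

(** * Independence and complements *)

Section Independence.
Context d (Omega : measurableType d) (R : realType).
Variable P : probability Omega R.

Lemma prob_ge0 (A : set Omega) : 0 <= prob P A.
Proof. by apply: fine_ge0; apply: measure_ge0. Qed.

Lemma prob_setDI (A B : set Omega) : measurable A -> measurable B ->
  prob P (A `\` B) = prob P A - prob P (A `&` B).
Proof.
move=> mA mB; rewrite /prob (measureDI P mA mB) fineD ?addrK//;
  apply: fin_num_measure; by [exact: measurableD | exact: measurableI].
Qed.

Lemma prob_setC (A : set Omega) : measurable A ->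
  prob P (~` A) = 1 - prob P A.
Proof.
by move=> mA; rewrite -setTD prob_setDI// setTI /prob probability_setT.
Qed.

Lemma le_prob (A B : set Omega) : measurable A -> measurable B ->
  A `<=` B -> prob P A <= prob P B.
Proof.
move=> mA mB AB; apply: fine_le; try exact: fin_num_measure.
by apply: le_measure => //; rewrite inE.
Qed.

Variable I : finType.
Implicit Types (A : I -> set Omega) (J K : {set I}).

Lemma measurable_bigcapset A J : (forall i, measurable (A i)) ->
  measurable (\bigcap_(i in [set i | i \in J]) A i).
Proof. by move=> mA; apply: fin_bigcap_measurable => //; exact: finite_finset. Qed.

Lemma bigcap_setD1 A J k : k \in J ->
  \bigcap_(i in [set i | i \in J]) A i =
  A k `&` \bigcap_(i in [set i | i \in (J :\ k)%SET]) A i.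
Proof.
move=> kJ; apply/seteqP; split=> [w Aw|w [Akw Aw] i /= iJ].
  by split; [exact: Aw|move=> i /= /setD1P[_ iJ]; exact: Aw].
by have [->//|ik] := eqVneq i k; apply: Aw; rewrite /= !inE ik.
Qed.

(** Complementing one event subtracts the product over [J] from the product
    over [J :\ k] when [k] is in [J]; what remains has the factor [1 - prob (A k)]. *)
Lemma mutually_independent_setC1 A k : mutually_independent P A ->
  mutually_independent P (fun i => if i == k then ~` A i else A i).
Proof.
move=> [mA iA]; split=> [i|J].
  by case: eqP => // _; exact: measurableC.
have [kJ|kJ] := boolP (k \in J); last first.
  have nk i : i \in J -> (i == k) = false.
    by move=> iJ; apply: contraNF kJ => /eqP <-.
  transitivity (prob P (\bigcap_(i in [set i | i \in J]) A i)).
    by congr prob; apply: eq_bigcapr => i /= /nk ->.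
  by rewrite iA; apply: eq_bigr => i /nk ->.
rewrite (bigcap_setD1 _ kJ) eqxx.
rewrite (_ : \bigcap_(i in _) _ =
    \bigcap_(i in [set i | i \in (J :\ k)%SET]) A i); last first.
  by apply: eq_bigcapr => i /= /setD1P[/negbTE ->].
rewrite setIC -setDE prob_setDI//; last exact: measurable_bigcapset.
rewrite setIC -(bigcap_setD1 A kJ) !iA (big_setD1 k kJ)/= [RHS](big_setD1 k kJ)/=.
rewrite eqxx prob_setC// -{1}[\prod_(i in _) _]mul1r -mulrBl; congr (_ * _).
by apply: eq_bigr => i /setD1P[/negbTE ->].
Qed.

Lemma mutually_independent_setC A K : mutually_independent P A ->
  mutually_independent P (fun i => if i \in K then ~` A i else A i).
Proof.
move=> iA.
suff H (s : seq I) : uniq s ->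
    mutually_independent P (fun i => if i \in s then ~` A i else A i).
  have := H _ (enum_uniq K); congr mutually_independent.
  by apply/funext => i; rewrite mem_enum.
elim: s => [//|k s IH] /= /andP[ks us].
have := mutually_independent_setC1 k (IH us); congr mutually_independent.
apply/funext => i; rewrite inE; have [->|//] := eqVneq i k.
by rewrite (negbTE ks).
Qed.

Lemma mutually_independent_prob_setD1 A J k : k \in J ->
  mutually_independent P A ->
  prob P (A k `&` \bigcap_(i in [set i | i \in (J :\ k)%SET]) A i) =
  prob P (A k) * prob P (\bigcap_(i in [set i | i \in (J :\ k)%SET]) A i).
Proof. by move=> kJ [_ iA]; rewrite -(bigcap_setD1 A kJ) !iA (big_setD1 k kJ). Qed.

End Independence.

(** * Binary tensors and the Hamming distance *)

Section Hamming.
Variables (R : realType) (n m l : nat).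
Implicit Types G W : tensor R n m l.

Definition binary_tensor W := forall t, W t = 0 \/ W t = 1.

Definition hamming G W : nat := #|[set t | G t != W t]%SET|.

Lemma rank_one_binary_outer (x : 'rV[R]_n) (y : 'rV[R]_m) (z : 'rV[R]_l) :
  binary_vec x -> binary_vec y -> binary_vec z ->
  rank_one_binary (outer x y z).
Proof. by move=> bx by_ bz; exists x, y, z. Qed.

Lemma rank_one_binary_binary W : rank_one_binary W -> binary_tensor W.
Proof.
move=> [x [y [z [bx by_ bz ->]]]] t; rewrite ffunE.
case: (bx t.1.1) => ->; first by left; rewrite !mul0r.
case: (by_ t.1.2) => ->; first by left; rewrite mulr0 mul0r.
by rewrite !mul1r; exact: bz.
Qed.

Lemma binary_tensor_neq W G t : binary_tensor W -> binary_tensor G ->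
  (G t != W t) = (1 - W t == G t).
Proof.
move=> /(_ t) bW /(_ t) bG; case: bW => ->; case: bG => ->;
  by rewrite ?subrr ?subr0 ?eqxx ?oner_eq0// eq_sym oner_eq0.
Qed.

(** Rank-one binary tensors are images of Boolean arrays. *)
Lemma finite_rank_one_binary :
  finite_set [set W : tensor R n m l | rank_one_binary W].
Proof.
apply: (@sub_finite_set _ _ (range
    (fun b : {ffun idx n m l -> bool} => [ffun t => (b t)%:R]))); last first.
  by apply: finite_image; exact: finite_finset.
move=> W /rank_one_binary_binary bW; exists [ffun t => W t == 1] => //.
apply/ffunP => t; rewrite !ffunE.
by case: (bW t) => ->; rewrite ?eqxx// eq_sym oner_eq0.
Qed.

Lemma frobenius_hamming G W : binary_tensor G -> binary_tensor W ->
  frobenius (G - W) ^+ 2 = (hamming G W)%:R.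
Proof.
move=> bG bW; rewrite sqr_sqrtr; last by apply: sumr_ge0 => t _; exact: sqr_ge0.
rewrite /hamming -sum1_card natr_sum [RHS]big_mkcond/=.
apply: eq_bigr => t _; rewrite !ffunE inE.
case: (bG t) (bW t) => -> [] ->;
  by rewrite ?subrr ?subr0 ?sub0r ?sqrrN ?expr1n ?expr0n ?eqxx ?oner_eq0//
     eq_sym oner_eq0.
Qed.

(** Competing triples and competing tensors define the same problem, so
    optimality is minimality of the Hamming distance. *)
Lemma optimal_solutionE G x y z : binary_tensor G ->
  binary_vec x -> binary_vec y -> binary_vec z ->
  optimal_solution G x y z <->
  forall W, rank_one_binary W -> (hamming G (outer x y z) <= hamming G W)%N.
Proof.
move=> bG bx by_ bz.
have E W : rank_one_binary W -> frobenius (G - W) ^+ 2 = (hamming G W)%:R.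
  by move=> /rank_one_binary_binary; exact: frobenius_hamming.
split=> [[_ _ _ opt] W rW|opt].
  have [x' [y' [z' [bx' by' bz' eW]]]] := rW.
  rewrite -(@ler_nat R) -!E//; last exact: rank_one_binary_outer.
  by rewrite eW; exact: opt.
split=> // x' y' z' bx' by' bz'.
have r' := rank_one_binary_outer bx' by' bz'.
rewrite !E//; last exact: rank_one_binary_outer.
by rewrite ler_nat; exact: opt.
Qed.

Lemma maximizes_over_rank_one_scale (F H : tensor R n m l -> R) (c : R) W :
  0 < c -> (forall V, rank_one_binary V -> H V = c * F V) ->
  maximizes_over_rank_one H W <-> maximizes_over_rank_one F W.
Proof.
move=> c0 HF; split=> -[rW opt]; split=> // V rV.
  by have := opt V rV; rewrite !HF// ler_pM2l.
by rewrite !HF// ler_pM2l//; exact: opt.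
Qed.

End Hamming.

(** * The likelihood as a function of the Hamming distance *)

Section NoiseWeight.
Variables (R : realType) (p : R).
Hypotheses (p_ge0 : 0 <= p) (p_lt_half : p < 1 / 2).

Let p_lt_q : p < 1 - p.
Proof. by move: p_lt_half => ?; lra. Qed.

Let q_gt0 : 0 < 1 - p.
Proof. exact: le_lt_trans p_ge0 p_lt_q. Qed.

Let q_ge0 := ltW q_gt0.

(** The probability of one given pattern of [k] corruptions among [N] entries. *)
Definition noise_weight (N k : nat) : R := p ^+ k * (1 - p) ^+ (N - k).

(** Going from [k] to [j] corruptions replaces [j - k] factors [1 - p] by [p];
    the common factor is [p ^ k * (1 - p) ^ (N - j)]. *)
Lemma noise_weight_le N k j : (k <= j <= N)%N ->
  noise_weight N j <= noise_weight N k.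
Proof.
move=> /andP[kj jN]; rewrite /noise_weight.
rewrite -{1}(subnKC kj) exprD.
have -> : (N - k = (j - k) + (N - j))%N by rewrite addnC addnBA// subnK.
rewrite exprD -!mulrA ler_wpM2l ?exprn_ge0// ler_wpM2r ?exprn_ge0//.
by apply: lerXn2r; rewrite ?nnegrE// ltW.
Qed.

(** Positivity of the larger weight forces the common factor to be nonzero,
    which matters for [p = 0]. *)
Lemma noise_weight_lt N k j : (k < j <= N)%N -> 0 < noise_weight N k ->
  noise_weight N j < noise_weight N k.
Proof.
move=> /andP[kj jN]; rewrite /noise_weight.
rewrite pmulr_lgt0; last exact: exprn_gt0.
move=> pk.
rewrite -{1}(subnKC (ltnW kj)) exprD.
have -> : (N - k = (j - k) + (N - j))%N by rewrite addnC addnBA ?(ltnW kj)// subnK.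
rewrite exprD -!mulrA ltr_pM2l// ltr_pM2r ?exprn_gt0//.
by rewrite ltrXn2r ?subn_eq0 -?ltnNge.
Qed.

End NoiseWeight.

Section Likelihood.
Context (R : realType) d (Omega : measurableType d).
Variables (P : probability Omega R) (n m l : nat) (p : R).
Variable C : idx n m l -> set Omega.
Implicit Types G W : tensor R n m l.

Lemma corrupt_binary W omega : binary_tensor W ->
  binary_tensor (corrupt C W omega).
Proof.
move=> bW t; rewrite ffunE; case: ifP => _ //.
by case: (bW t) => ->; [right; rewrite subr0|left; rewrite subrr].
Qed.

(** An observation of positive probability is attained at some sample point. *)
Lemma observable_binary G : observable P C G -> binary_tensor G.
Proof.
move=> [W [rW]]; rewrite /likelihood; have [->|/set0P[omega <- _]] :=
    eqVneq [set omega | corrupt C W omega = G] set0; last first.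
  by apply: corrupt_binary; exact: rank_one_binary_binary.
by rewrite /prob measure0 ltxx.
Qed.

(** The event that corruption turns the entry [W t] into [G t]. *)
Definition match_event G W t : set Omega :=
  if t \in [set s | G s == W s]%SET then ~` C t else C t.

Lemma corrupt_eqP G W omega : binary_tensor G -> binary_tensor W ->
  corrupt C W omega = G <-> forall t, match_event G W t omega.
Proof.
move=> bG bW; rewrite /match_event; split=> [eG t|eG].
  rewrite inE; case: ifPn => [/eqP e|]; last first.
    by rewrite -eG ffunE; case: asboolP => //; rewrite eqxx.
  move=> Ct; have := binary_tensor_neq t bW bG.
  by rewrite -{2}eG ffunE asboolT// eqxx e eqxx.
apply/ffunP => t; rewrite ffunE; have := eG t; rewrite inE.
case: ifPn => [/eqP -> nC|GW Ct]; first by rewrite asboolF.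
rewrite asboolT//; apply/eqP.
by rewrite -(binary_tensor_neq t bW bG).
Qed.

Lemma corrupt_event G W : binary_tensor G -> binary_tensor W ->
  [set omega | corrupt C W omega = G] =
  \bigcap_(t in [set t | t \in [set: idx n m l]%SET]) match_event G W t.
Proof.
move=> bG bW; apply/seteqP; split=> omega /=.
  by move=> /corrupt_eqP H t _; exact: H.
by move=> H; apply/corrupt_eqP => // t; apply: H; rewrite /= inE.
Qed.

Lemma measurable_corrupt G W : mutually_independent P C ->
  binary_tensor G -> binary_tensor W ->
  measurable [set omega | corrupt C W omega = G].
Proof.
move=> iC bG bW; rewrite corrupt_event//; apply: measurable_bigcapset.
by have [] := mutually_independent_setC [set s | G s == W s]%SET iC.
Qed.

Lemma likelihoodE G W : corruption_model P p C ->
  binary_tensor G -> binary_tensor W ->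
  likelihood P C G W = noise_weight p #|{: idx n m l}| (hamming G W).
Proof.
move=> [iC Cp] bG bW; rewrite /likelihood corrupt_event//.
pose K := [set s | G s == W s]%SET.
have [mC iK] := mutually_independent_setC K iC.
rewrite [X in prob P X](_ : _ = \bigcap_(t in [set t | t \in [set: idx n m l]%SET])
  (if t \in K then ~` C t else C t))// iK.
rewrite (bigID [in ~: K]%SET)/= /noise_weight; congr (_ * _).
  rewrite (eq_bigr (fun=> p)) => [|t /andP[_]]; last first.
    by rewrite inE => /negbTE ->; exact: Cp.
  rewrite prodr_const; congr (p ^+ _).
  by rewrite /hamming; apply: eq_card => t; rewrite [LHS]unfold_in /= !inE.
rewrite (eq_bigr (fun=> 1 - p)) => [|t /andP[_]]; last first.
  by rewrite inE negbK => ->; rewrite prob_setC ?Cp//; case: iC.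
rewrite prodr_const -[X in (X - _)%N](cardsC K) [X in (_ - X)%N](_ : _ = #|~: K|).
  by rewrite addnK; congr (_ ^+ _); apply: eq_card => t; rewrite [LHS]unfold_in /= !inE negbK.
by rewrite /hamming; apply: eq_card => t; rewrite !inE.
Qed.

(** A strictly closer competitor would be strictly more likely, because the
    likelihood of a maximizer is positive by observability. *)
Lemma maximizes_likelihoodE G W : 0 <= p -> p < 1 / 2 ->
  corruption_model P p C -> observable P C G -> rank_one_binary W ->
  maximizes_over_rank_one (likelihood P C G) W <->
  forall V, rank_one_binary V -> (hamming G W <= hamming G V)%N.
Proof.
move=> p_ge0 p_lt_half modelC obsG rW.
have bG := observable_binary obsG.
have LE V : rank_one_binary V ->
    likelihood P C G V = noise_weight p #|{: idx n m l}| (hamming G V).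
  by move=> /rank_one_binary_binary; exact: likelihoodE.
split=> [[_ maxW] V rV|minW].
  have [V0 [rV0 LV0]] := obsG.
  have LW : 0 < likelihood P C G W by exact: lt_le_trans LV0 (maxW _ rV0).
  rewrite leqNgt; apply/negP => VW.
  have := maxW V rV; rewrite leNgt => /negP; apply.
  rewrite LE// [ltRHS]LE//; apply: noise_weight_lt => //.
    by rewrite VW max_card.
  apply: (lt_le_trans LW); rewrite LE//.
  by apply: noise_weight_le => //; rewrite ltnW//= max_card.
split=> // V rV; rewrite LE// LE//.
by apply: noise_weight_le => //; rewrite minW// max_card.
Qed.

End Likelihood.

(** * Bayes' rule under the uniform prior *)

Section Posterior.
Context (R : realType) d (Omega : measurableType d).
Variables (P : probability Omega R) (n m l : nat).
Variables (C : idx n m l -> set Omega) (W : Omega -> tensor R n m l).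
Hypothesis uniformW : uniform_ground_truth P C W.
Implicit Types G w : tensor R n m l.

Lemma measurable_ground_truth w : rank_one_binary w ->
  measurable [set omega | W omega = w].
Proof. by have [_ _ H] := uniformW; move=> /H [mA _]; exact: (mA None). Qed.

(** Otherwise every value of [W] would have probability zero, and so would the
    whole space, being covered by finitely many of these events. *)
Lemma prior_gt0 w : rank_one_binary w -> 0 < prob P [set omega | W omega = w].
Proof.
move=> rw; rewrite lt_neqAle prob_ge0 andbT eq_sym; apply/eqP => w0.
have [rW eqW _] := uniformW.
have null v : rank_one_binary v -> P [set omega | W omega = v] = 0%E.
  move=> rv; have := eqW v w rv rw; rewrite w0 /prob => /eqP.
  rewrite fine_eq0; first by move=> /eqP.
  by apply: fin_num_measure; exact: measurable_ground_truth.
have : (P setT <= \sum_(v \in [set v | rank_one_binary v])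
    P [set omega | W omega = v])%E.
  apply: content_sub_fsum => // [|v|omega _].
  - exact: finite_rank_one_binary.
  - exact: measurable_ground_truth.
  - by exists (W omega) => //=; exact: rW.
by rewrite probability_setT fsbig1// lee_fin ler10.
Qed.

(** The corruption event is an intersection of events [C t] and complements,
    so it is independent of [W = w]. *)
Lemma prob_ground_truth_observed G w : binary_tensor G -> rank_one_binary w ->
  prob P ([set omega | W omega = w] `&` [set omega | corrupt C (W omega) omega = G])
  = prob P [set omega | W omega = w] * likelihood P C G w.
Proof.
move=> bG rw; have bw := rank_one_binary_binary rw.
have [_ _ /(_ w rw) iA] := uniformW.
(* [None] stays out of [K]: the event [W = w] is not complemented. *)
pose K := [set o | if o is Some t then G t == w t else false]%SET.
have iB := mutually_independent_setC K iA.
pose A (o : option (idx n m l)) :=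
  if o is Some t then C t else [set omega | W omega = w].
pose B o := if o \in K then ~` A o else A o.
have BN : B None = [set omega | W omega = w] by rewrite /B inE.
have BS : \bigcap_(o in [set o | o \in ([set: option (idx n m l)] :\ None)%SET]) B o
    = [set omega | corrupt C w omega = G].
  rewrite corrupt_event//; apply/seteqP; split=> omega /= Bo.
    move=> t _; have := Bo (Some t); rewrite /= !inE /B /match_event !inE.
    exact.
  case=> [t|] /=; last by rewrite !inE.
  by move=> _; have := Bo t; rewrite /= !inE /B /match_event !inE; exact.
have /= := mutually_independent_prob_setD1 (A := B) (finset.in_setT None) iB.
rewrite BS BN => <-; congr prob.
by apply/seteqP; split=> omega [/= Ww]; rewrite Ww.
Qed.

Lemma measurable_observed G : mutually_independent P C -> binary_tensor G ->
  measurable [set omega | corrupt C (W omega) omega = G].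
Proof.
move=> iC bG; have [rW _ _] := uniformW.
rewrite [X in measurable X](_ : _ =
    \bigcup_(w in [set w | rank_one_binary w])
      ([set omega | W omega = w] `&` [set omega | corrupt C w omega = G])).
  apply: fin_bigcup_measurable => [|w rw]; first exact: finite_rank_one_binary.
  apply: measurableI; first exact: measurable_ground_truth.
  exact: measurable_corrupt iC bG (rank_one_binary_binary rw).
(* On [W = w] the observation is the corruption of the constant [w]. *)
apply/seteqP; split=> omega /=; first by exists (W omega); [exact: rW|].
by move=> [w _ /= [-> ]].
Qed.

Lemma evidence_gt0 G : mutually_independent P C -> observable P C G ->
  0 < prob P [set omega | corrupt C (W omega) omega = G].
Proof.
move=> iC obsG; have bG := observable_binary obsG; have [w [rw Lw]] := obsG.
have mG := measurable_observed iC bG.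
have := mulr_gt0 (prior_gt0 rw) Lw; rewrite -prob_ground_truth_observed//.
move=> /lt_le_trans; apply; apply: le_prob => [||omega []//]; last exact: mG.
by apply: measurableI => //; exact: measurable_ground_truth.
Qed.

(** The reference tensor [w0] makes it visible that the factor is the same for
    all rank-one binary [w]. *)
Lemma posteriorE G w0 w : binary_tensor G ->
  rank_one_binary w0 -> rank_one_binary w ->
  posterior P C W G w =
  prob P [set omega | W omega = w0] /
    prob P [set omega | corrupt C (W omega) omega = G] * likelihood P C G w.
Proof.
move=> bG rw0 rw; have [_ eqW _] := uniformW.
by rewrite /posterior /cond_prob prob_ground_truth_observed// (eqW _ _ rw0 rw) mulrAC.
Qed.

End Posterior.

Unset Implicit Arguments.
Set Strict Implicit.

Theorem proposition1 (R : realType) (d : measure_display)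
    (Omega : measurableType d) (P : probability Omega R) (n m l : nat) (p : R)
    (C : idx n m l -> set Omega) (G : tensor R n m l)
    (p_ge0 : 0 <= p) (p_lt_half : p < 1 / 2)
    (modelC : corruption_model P p C) (obsG : observable P C G) :
  (forall (x : 'rV[R]_n) (y : 'rV[R]_m) (z : 'rV[R]_l),
     binary_vec x -> binary_vec y -> binary_vec z ->
     (optimal_solution G x y z <->
      maximizes_over_rank_one (likelihood P C G) (outer x y z))) /\
  (forall W : Omega -> tensor R n m l, uniform_ground_truth P C W ->
   forall (x : 'rV[R]_n) (y : 'rV[R]_m) (z : 'rV[R]_l),
     binary_vec x -> binary_vec y -> binary_vec z ->
     (optimal_solution G x y z <->
      maximizes_over_rank_one (posterior P C W G) (outer x y z))).
Proof.
have bG := observable_binary obsG.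
have ml x y z : binary_vec x -> binary_vec y -> binary_vec z ->
    (optimal_solution G x y z <->
     maximizes_over_rank_one (likelihood P C G) (outer x y z)).
  move=> bx by_ bz; rewrite optimal_solutionE//.
  rewrite (maximizes_likelihoodE p_ge0 p_lt_half modelC obsG)//.
  exact: rank_one_binary_outer.
split=> // W uW x y z bx by_ bz; rewrite ml//.
have rxyz := rank_one_binary_outer bx by_ bz.
have [iC _] := modelC.
symmetry; apply: (maximizes_over_rank_one_scale
  (c := prob P [set omega | W omega = outer x y z] /
        prob P [set omega | corrupt C (W omega) omega = G])).
  by rewrite divr_gt0 ?(prior_gt0 uW)// (evidence_gt0 uW).
by move=> w rw; exact: posteriorE.
Qed.
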